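(* Let $(G,d)$ be a boundedly compact, $p$-uniformly convex metric space with $p\in(1,2]$. Let $(x^k)_{k\in\mathbb{N}}$ be a sequence generated by the basic descent algorithm for $f:G\to\mathbb{R}$ and let $(y^k,\lambda_k)_{k\in\mathbb{N}}$ be the corresponding sequence of descent steps and step scalings. Assume that (i) $f:G\to\mathbb{R}$ is level-bounded and has local uniform Lipschitz gradient along geodesics with constant $L>0$ on the convex subset $U\subset G$; (ii) $\mathrm{lev}_{\leq f(x^0)}(f)\subset\mathrm{gi}(U)$ with distance at least $\rho>0$ to the boundary of $U$, i.e. $\bigcup_{x\in\mathrm{lev}_{\le f(x^0)}(f)}B_\rho(x)\subset\mathrm{gi}(U)$; (iii) in each step $k$ with $\mathcal D_k\neq\emptyset$ the descent step $y^k\in\mathcal D_k$ is a steepest descent step with $d(x^k,y^k)=\rho$, i.e. $$Df(x^k)[\gamma_{[x^k,y^k]}]=-|D|f(x^k)\quad\text{and}\quad d(x^k,y^k)=\rho .$$ Then there exists a uniform constant $\underline\delta>0$ such that for all $\delta\geq\underline\delta$ and all $k$, $[\alpha_k,\beta_k]\cap(0,1]\neq\emptyset$, where $$\alpha_k:=-\Bigl(\frac{2+L}{2\delta}\Bigr)\frac{|D|f(x^k)^{\frac{2}{p-1}}}{df(x^k)[\gamma_{[x^k,y^k]}]},\qquad \beta_k:=\frac{|D|f(x^k)^{\frac1{p-1}}}{\sqrt\delta\,d(x^k,y^k)},$$ and whenever $\lambda_k\in[\alpha_k,\beta_k]\cap(0,1]$ the sufficient decrease condition $$f(x^{k+1})-f(x^k)\leq-\frac1\delta|D|f(x^k)^{\frac{2}{p-1}}\qquad\text{for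 all }k\in\mathbb{N}$$ holds.
   Context: Spaces. A metric space $(G,d)$ is uniquely geodesic if for all $x_0,x_1\in G$ there is a unique path $\gamma=\gamma_{[x_0,x_1]}:[0,1]\to G$ with $\gamma(0)=x_0$, $\gamma(1)=x_1$ and $d(\gamma(t),\gamma(s))=|t-s|\,d(x_0,x_1)$ for all $s,t\in[0,1]$; write $(1-t)x_0\oplus t x_1:=\gamma(t)$. It is $p$-uniformly convex ($p>1$, constant $c>0$) if it is uniquely geodesic and for all $x_0,x_1,y\in G$, $t\in[0,1]$, with $x_t=(1-t)x_0\oplus tx_1$: $d(x_t,y)^p\leq(1-t)d(x_0,y)^p+t\,d(x_1,y)^p-\frac c2 t(1-t)d(x_0,x_1)^p$. Boundedly compact means closed bounded sets are compact. For $x\in G$, $G_x:=\{\gamma_{[x,y]}\mid y\in G\}$ with metric $d_x(\gamma_1,\gamma_2):=d(\gamma_1(1),\gamma_2(1))$, and $G_x^\circ:=G_x\setminus\{\gamma_{[x,x]}\}$. $B_r(x)$ is the closed ball. A set $U\subset G$ is convex if it contains $\gamma_{[x,y]}(t)$ for all $x,y\in U$, $t\in[0,1]$. The geodesic interior of $V\subset G$ is $\mathrm{gi}(V):=\{x\in V\mid \forall y\in V\setminus\{x\}\ \exists\eta\in G_y^\circ,\ t\in(0,1)\text{ with }x=\eta(t)\}$. $\mathrm{lev}_{\le\alpha}(f):=\{x\in G\mid f(x)\le\alpha\}$; $f$ is level-bounded if all these sets ($\alpha\in\mathbb R$) are bounded. Derivatives. For $\gamma\in G_x$: $S^-f(x)[\gamma]:=\liminf_{t\searrow0}\frac{f(\gamma(t))-f(x)}{t}$,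 $S^+f(x)[\gamma]:=\limsup_{t\searrow0}\frac{f(\gamma(t))-f(x)}{t}$, $d^-f(x)[\gamma]:=\liminf_{\eta\to\gamma}S^-f(x)[\eta]$, $d^+f(x)[\gamma]:=\limsup_{\eta\to\gamma}S^+f(x)[\eta]$, where $\eta\to\gamma$ in $(G_x,d_x)$ and $\eta=\gamma$ is allowed. For $\gamma\in G_x^\circ$, $D^\pm f(x)[\gamma]:=d^\pm f(x)[\gamma]/d(\gamma(0),\gamma(1))$. $f$ is directionally differentiable at $x$ in direction $\gamma$ if $d^+f(x)[\gamma]=d^-f(x)[\gamma]=df(x)[\gamma]:=\lim_{t\searrow0}\frac{f(\gamma(t))-f(x)}{t}\in\mathbb{R}$; then $Df(x)[\gamma]:=df(x)[\gamma]/d(\gamma(0),\gamma(1))$ for $\gamma\in G_x^\circ$. The steepness of $f$ at $x$ is $|D|f(x):=\sup_{\gamma\in G_x^\circ}|D^+f(x)[\gamma]|\in[0,+\infty]$. Lipschitz gradient. For convex $U$, $C^1(U)$ is the set of continuous $f$ on $U$ such that $t\mapsto f(\gamma_{[x,y]}(t))$ is $C^1$ on $[0,1]$ for all distinct $x,y\in U$. $f$ has local uniform Lipschitz gradient along geodesics with constant $L$ on $U$ if $f\in C^1(U)$ and for all (distinct) $x,y\in U$, all $t,s\in[0,1)$, with $x_t=\gamma_{[x,y]}(t)$, $x_s=\gamma_{[x,y]}(s)$: $|Df(x_t)[\gamma_{[x_t,y]}]-Df(x_s)[\gamma_{[x_s,y]}]|\le L\,d(x_t,x_s)$. Basic descent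 algorithm. Choose $x^0\in G$, $k=0$. Let $\mathcal D_k:=\{y\in G\setminus\{x^k\}\mid D^-f(x^k)[\gamma_{[x^k,y]}]<0\}$. While $\mathcal D_k\ne\emptyset$: choose a descent step $y^k\in\mathcal D_k$ and step scaling $\lambda_k\in(0,1]$, set $x^{k+1}=(1-\lambda_k)x^k\oplus\lambda_ky^k$ and increase $k$ by one.
   Formalization: Nonemptiness of [α_k,β_k]∩(0,1] is claimed only at steps with f(x^k) ≤ f(x^0) (automatic if all earlier λ_j lie in their ranges); for arbitrary earlier λ_j it can fail, as iterates may leave U where |D|f is unbounded. *)

(* Defs.v *)
From mathcomp Require Import all_boot all_order all_algebra.
From mathcomp Require Import all_classical all_reals all_analysis.

Set Implicit Arguments.
Unset Strict Implicit.
Unset Printing Implicit Defensive.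

Import Order.TTheory GRing.Theory Num.Theory.
Import numFieldNormedType.Exports.

Local Open Scope classical_set_scope.
Local Open Scope ring_scope.

Section Geodesics.
Context {R : realType} {G : metricType R}.
Implicit Types (x y : G) (g : R -> G) (U A : set G).

(* A path [0,1] -> G is a function R -> G whose values outside [0,1] are
   irrelevant. *)
Definition is_geodesic x0 x1 g : Prop :=
  [/\ g 0 = x0, g 1 = x1 &
      forall t s, t \in `[0, 1] -> s \in `[0, 1] ->
        mdist (g t) (g s) = `|t - s| * mdist x0 x1].

(* The geodesic from [x0] to [x1], meaningful in a uniquely geodesic space
   (constant path if there is none): [geod x0 x1 t] is (1-t)x0 (+) t x1. *)
Definition geod x0 x1 : R -> G :=
  xget (cst x0 : R -> G) [set g | is_geodesic x0 x1 g].

(* G_x and G_x without the constant geodesic. *)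
Definition geods x : set (R -> G) := range (geod x).

Definition geods0 x : set (R -> G) := geods x `\ geod x x.

Definition geod_convex U : Prop :=
  forall x y t, U x -> U y -> t \in `[0, 1] -> U (geod x y t).

Definition geod_interior U : set G :=
  [set x | U x /\ forall y, U y -> y <> x ->
     exists g t, [/\ geods0 y g, t \in `]0, 1[ & x = g t]].

Definition mbounded A : Prop :=
  exists M : R, forall x y, A x -> A y -> mdist x y <= M.

Definition mclosed_ball x (r : R) : set G := [set y | mdist x y <= r].

Definition sublevel (f : G -> R) (a : R) : set G := [set x | f x <= a].

Definition level_bounded (f : G -> R) : Prop :=
  forall a : R, mbounded (sublevel f a).

End Geodesics.

Section Spaces.
Context {R : realType} (G : metricType R).

Definition uniquely_geodesic : Prop :=
  forall x0 x1 : G, exists g, is_geodesic x0 x1 g /\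
    forall g', is_geodesic x0 x1 g' -> {in `[0, 1], g =1 g'}.

Definition uniformly_convex (p c : R) : Prop :=
  uniquely_geodesic /\
  forall (x0 x1 y : G) (t : R), t \in `[0, 1] ->
    mdist (geod x0 x1 t) y `^ p <=
      (1 - t) * mdist x0 y `^ p + t * mdist x1 y `^ p
      - c / 2 * t * (1 - t) * mdist x0 x1 `^ p.

Definition boundedly_compact : Prop :=
  forall A : set G, closed A -> mbounded A -> compact A.

End Spaces.

Section Derivatives.
Context {R : realType} {G : metricType R}.
Implicit Types (f : G -> R) (x y : G) (g : R -> G) (U : set G).

Definition diff_quot f x g (t : R) : R := (f (g t) - f x) / t.

Definition S_inf f x g : \bar R :=
  limf_einf (fun t : R => (diff_quot f x g t)%:E) (0 : R)^'+.

Definition S_sup f x g : \bar R :=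
  limf_esup (fun t : R => (diff_quot f x g t)%:E) (0 : R)^'+.

(* liminf/limsup over h -> g in (G_x, d_x); since d_x compares end points,
   y |-> geod x y is an isometry of G onto G_x, and h = geod x y tends to g
   when y tends to g 1. The full filter [nbhs] allows h = g. *)
Definition d_inf f x g : \bar R :=
  limf_einf (fun y : G => S_inf f x (geod x y)) (nbhs (g 1)).

Definition d_sup f x g : \bar R :=
  limf_esup (fun y : G => S_sup f x (geod x y)) (nbhs (g 1)).

Definition Dn_inf f x g : \bar R :=
  (d_inf f x g * ((mdist (g 0) (g 1))^-1)%:E)%E.

Definition Dn_sup f x g : \bar R :=
  (d_sup f x g * ((mdist (g 0) (g 1))^-1)%:E)%E.

(* Total version of df(x)[g]; meaningful when the limit exists. *)
Definition dir_d f x g : R := lim (diff_quot f x g t @[t --> (0 : R)^'+]).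

Definition dir_differentiable f x g : Prop :=
  [/\ cvg (diff_quot f x g t @[t --> (0 : R)^'+]),
      d_sup f x g = (dir_d f x g)%:E & d_inf f x g = (dir_d f x g)%:E].

Definition dir_D f x g : R := dir_d f x g / mdist (g 0) (g 1).

(* Valued in [0,+oo]: the [maxe 0] only sets the supremum over an empty G_x
   without constant geodesic, i.e. when G is a singleton, to 0. *)
Definition steepness f x : \bar R :=
  maxe 0%E (ereal_sup [set `|Dn_sup f x g|%E | g in geods0 x]).

(* C^1 on [0,1], with one-sided derivatives at the end points. *)
Definition C1_unit (phi : R -> R) : Prop :=
  exists dphi : R -> R,
    {within `[0, 1], continuous dphi} /\
    forall t, t \in `[0, 1] ->
      (phi s - phi t) / (s - t) @[s --> within `[0, 1] t^'] --> dphi t.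

Definition C1_on U f : Prop :=
  {within U, continuous f} /\
  forall x y, U x -> U y -> x <> y -> C1_unit (fun t => f (geod x y t)).

(* For [f] in C^1(U) the limits defining the two values of [dir_D] exist. *)
Definition lipschitz_gradient U f (L : R) : Prop :=
  C1_on U f /\
  forall x y, U x -> U y -> x <> y ->
  forall t s : R, t \in `[0, 1[ -> s \in `[0, 1[ ->
    let xt := geod x y t in
    let xs := geod x y s in
    `|dir_D f xt (geod xt y) - dir_D f xs (geod xs y)| <= L * mdist xt xs.

Definition descent_points f x : set G :=
  [set y | y <> x /\ (Dn_inf f x (geod x y) < 0)%E].

(* Step [k] is executed: the loop test succeeds at steps 0, ..., k. *)
Definition executed f (x : nat -> G) (k : nat) : Prop :=
  forall j, (j <= k)%N -> descent_points f (x j) !=set0.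

(* A run of the algorithm. If the loop test fails at some step the run stops
   there, and the later entries of the three sequences are irrelevant. *)
Definition basic_descent f (x y : nat -> G) (lambda : nat -> R) : Prop :=
  forall k, executed f x k ->
    [/\ descent_points f (x k) (y k), lambda k \in `]0, 1] &
        x k.+1 = geod (x k) (y k) (lambda k)].

Definition steepest_step f x y (rho : R) : Prop :=
  [/\ dir_differentiable f x (geod x y),
      ((dir_D f x (geod x y))%:E = - steepness f x)%E &
      mdist x y = rho].

(* [fine (steepness f x)] is |D|f(x) whenever it is finite, which holds at
   every x admitting a steepest step. *)
Definition step_lower f (p L delta : R) x y : R :=
  - ((2 + L) / (2 * delta)) *
    (fine (steepness f x) `^ (2 / (p - 1)) / dir_d f x (geod x y)).

Definition step_upper f (p delta : R) x y : R :=
  fine (steepness f x) `^ (1 / (p - 1)) / (Num.sqrt delta * mdist x y).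

Definition step_range f (p L delta : R) x y : set R :=
  `[step_lower f p L delta x y, step_upper f p delta x y] `&` `]0, 1].

Definition sufficient_decrease f (p delta : R) x x' : Prop :=
  f x' - f x <= - (1 / delta) * fine (steepness f x) `^ (2 / (p - 1)).

End Derivatives.

(* Main.v *)
(* Along a geodesic of length d from x in U to y in U, phi t = f (geod x y t)
   satisfies |phi' t - phi' s| <= L d^2 |t - s|, whence
   f (geod x y t) <= f x + t df(x) + L/2 (t d)^2.  With d = rho and
   df(x) = - a rho, where a = |D|f(x), the two bounds on the step scaling turn
   this into the sufficient decrease.  The sublevel set is compact, so f is
   bounded below; the quadratic bound at t = 1 then bounds a uniformly, and
   since 1/(p - 1) >= 1 all powers of a that delta has to dominate have
   nonnegative exponents. *)
Require Import Defs.
From mathcomp Require Import all_boot all_order all_algebra.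
From mathcomp Require Import all_classical all_reals all_analysis.
From mathcomp Require Import ring lra.
Import Order.TTheory GRing.Theory Num.Theory.
Import numFieldNormedType.Exports.
Local Open Scope classical_set_scope.
Local Open Scope ring_scope.

(** * One-sided derivatives on the unit interval *)

Section Calculus.
Context {R : realType}.
Implicit Types (phi dphi : R -> R).

(* The differentiability part of [C1_unit]. *)
Definition diff_unit phi dphi : Prop := forall t, t \in `[0, 1] ->
  (phi s - phi t) / (s - t) @[s --> within `[0, 1] t^'] --> dphi t.

(** [phi s] equals [phi t] plus the quotient times [s - t], also at [s = t], where the last factor
    vanishes; the product tends to zero. *)
Lemma cvg_diff_quot {F : set_system R} {FF : Filter F} {phi} {t l : R} :
  (phi s - phi t) / (s - t) @[s --> F] --> l -> F --> t ->
  phi s @[s --> F] --> phi t.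
Proof.
move=> quot idF.
have phiE : phi = fun s => phi t + (phi s - phi t) / (s - t) * (s - t).
  apply/funext => s; have [->|st] := eqVneq s t.
    by rewrite !subrr mulr0 addr0.
  by rewrite divfK ?subr_eq0// addrC subrK.
have -> : phi t = phi t + l * (t - t) by rewrite subrr mulr0 addr0.
rewrite [in X in X --> _]phiE.
apply: cvgD; first exact: cvg_cst.
by apply: cvgM => //; apply: cvgB => //; exact: cvg_cst.
Qed.

Lemma diff_unit_continuous {phi dphi} : diff_unit phi dphi ->
  {within `[0, 1], continuous phi}.
Proof.
move=> D; apply/subspace_continuousP => t t01.
have FF : Filter (within `[0, 1]%classic (t : R)^') by exact: within_filter.
have phit : phi s @[s --> within `[0, 1] t^'] --> phi t.
  apply: (cvg_diff_quot (FF := FF) (D t t01)).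
  by apply: cvg_trans; [apply: cvg_within|apply: cvg_within].
move=> B nB.
have near_t : nbhs (t : R) (fun s => s != t -> s \in `[0, 1] -> B (phi s)).
  exact: phit.
(* The quotient controls [phi] only off [t], while the subspace filter also sees [t] itself; there
   [B] holds as a neighbourhood of [phi t]. *)
change (nbhs (t : R) (fun s => s \in `[0, 1] -> B (phi s))).
apply: filterS near_t => s h s01.
have [->|st] := eqVneq s t; first exact: nbhs_singleton.
exact: h.
Qed.

(** The substitution runs through the tail of the interval from [t] to 1 at unit time; [1 - t] is
    the chain rule factor. *)
Lemma diff_unit_right {phi dphi} {t : R} :
  diff_unit phi dphi -> t \in `[0, 1[ ->
  (phi (t + s * (1 - t)) - phi t) / s @[s --> 0^'+] --> (1 - t) * dphi t.
Proof.
move=> D; rewrite in_itv/= => /andP[t0 t1].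
have t01 : t \in `[0, 1] by rewrite in_itv/= t0 ltW.
have pos : 0 < 1 - t by rewrite subr_gt0.
have aux : (t + s * (1 - t)) @[s --> 0^'+] --> within `[0, 1]%classic t^'.
  move=> P; rewrite /within/= => -[e e0 h].
  (* The bound [1] on [s] keeps [t + s * (1 - t)] inside the unit interval. *)
  have d0 : 0 < Num.min e 1 by rewrite lt_min e0 ltr01.
  exists (Num.min e 1) => //= s /=; rewrite sub0r normrN => se s0.
  move: se; rewrite gtr0_norm// lt_min => /andP[se s1].
  have h1 : s * (1 - t) <= s by apply: ler_piMr; [exact: ltW|lra].
  have h2 : s * (1 - t) <= 1 - t by apply: ler_piMl; exact: ltW.
  have h3 : 0 < s * (1 - t) by rewrite mulr_gt0.
  apply: h => /=.
  - by rewrite opprD addrA subrr sub0r normrN gtr0_norm// (le_lt_trans h1).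
  - by rewrite -subr_eq0 addrC addKr gt_eqF.
  - by rewrite in_itv/=; apply/andP; split; lra.
have quot := cvg_comp _ _ aux (D t t01).
have lim_t : (1 - t) * ((phi (t + s * (1 - t)) - phi t) / (t + s * (1 - t) - t))
    @[s --> 0^'+] --> (1 - t) * dphi t.
  by apply: cvgM; [exact: cvg_cst|exact: quot].
apply: cvg_trans lim_t; apply: near_eq_cvg; near=> s.
have s0 : s != 0 by rewrite gt_eqF//; near: s; exact: nbhs_right_gt.
rewrite /=.
have -> : t + s * (1 - t) - t = s * (1 - t) by ring.
by field; rewrite s0 gt_eqF.
Unshelve. all: by end_near. Qed.

Lemma diff_unit_is_derive {phi dphi} {t : R} :
  diff_unit phi dphi -> t \in `]0, 1[ ->
  is_derive t 1 phi (dphi t).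
Proof.
move=> D t01.
have t01' : t \in `[0, 1] by apply: subset_itv_oo_cc.
have key : (fun h : R => h^-1 *: ((phi \o shift t) (h *: 1) - phi t)) @ 0^'
             --> dphi t.
  have aux : h + t @[h --> (0:R)^'] --> within `[0, 1]%classic t^'.
    move: t01; rewrite in_itv/= => /andP[t0 t1].
    move=> P; rewrite /within/= => -[e e0 H].
    have d0 : 0 < Num.min e (Num.min t (1 - t)).
      by rewrite !lt_min e0 t0 subr_gt0.
    exists (Num.min e (Num.min t (1 - t))) => //= s /=; rewrite sub0r normrN.
    rewrite !lt_min => /and3P[se st s1t] s0; apply: H => /=.
    - by rewrite opprD addrCA subrr addr0 normrN.
    - by rewrite -subr_eq0 addrK.
    - have := ler_norm s; have := ler_norm (- s); rewrite normrN in_itv/=.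
      by move=> ? ?; apply/andP; split; lra.
  have quot := cvg_comp _ _ aux (D t t01').
  apply: cvg_trans quot; apply: near_eq_cvg; near=> s.
  by rewrite /= addrK /GRing.scale/= mulr1 mulrC.
apply: DeriveDef; first by apply/cvg_ex; exists (dphi t).
exact: cvg_lim.
Unshelve. all: by end_near. Qed.

(** Subtracting the linear and quadratic terms from [phi] leaves a function with nonpositive
    derivative inside the interval and continuous up to its ends, hence nonincreasing. *)
Lemma quadratic_upper_bound {phi dphi} {K t : R} : diff_unit phi dphi ->
  {in `]0, 1[, forall s, dphi s <= dphi 0 + K * s} -> t \in `[0, 1] ->
  phi t <= phi 0 + t * dphi 0 + K / 2 * t ^+ 2.
Proof.
move=> D dphi_le t01.
pose psi s := phi s - (s * dphi 0 + K / 2 * s ^+ 2).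
pose dpsi s := dphi s - (dphi 0 + K * s).
have Dpsi (s : R) : s \in `]0, 1[ -> is_derive s 1 psi (dpsi s).
  move=> s01; have ? := diff_unit_is_derive D s01.
  rewrite /psi; apply: is_derive_eq.
  by rewrite /dpsi /GRing.scale/= /cst/=; field.
have dpsi_le (s : R) : s \in `]0, 1[ -> psi^`()%classic s <= 0.
  move=> s01; have ? := Dpsi s s01.
  by rewrite derive1E derive_val subr_le0; exact: dphi_le.
have cpsi : {within `[0, 1], continuous psi}.
  move=> s; apply: cvgB; first exact: (diff_unit_continuous D).
  suff : {within `[0, 1], continuous (fun s => s * dphi 0 + K / 2 * s ^+ 2)}.
    exact.
  apply: continuous_subspaceT => {}s.
  apply: cvgD; first by apply: cvgMl; exact: cvg_id.
  by apply: cvgMr; exact: exprn_continuous.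
have dvpsi (s : R) : s \in `]0, 1[ -> derivable psi s 1.
  by move=> s01; exact: (@ex_derive _ _ _ _ _ _ _ (Dpsi s s01)).
have := @ler0_derive1_le_cc _ psi 0 1 dvpsi dpsi_le cpsi.
move: (t01); rewrite in_itv/= => /andP[t0 t1].
move=> /(_ t 0); rewrite t01 in_itv/= lexx ler01 => /(_ isT isT t0).
by rewrite /psi mul0r expr0n/= mulr0 addr0 subr0; lra.
Qed.

End Calculus.

(** * Geodesics, derivatives along them, and compact sublevel sets *)

Section Geometry.
Context {R : realType} {G : metricType R}.
Implicit Types (f : G -> R) (x y : G) (U : set G).

Lemma geodP x y : uniquely_geodesic G -> is_geodesic x y (geod x y).
Proof. by move=> /(_ x y)[g [? _]]; apply: xgetPex; exists g. Qed.

(** The affinely reparametrised tail of a geodesic is a geodesic between its own end points. As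
    [geod] is a choice, both paths are compared with the witness of uniqueness, on the unit interval
    only. *)
Lemma geod_geod x y (t s : R) : uniquely_geodesic G -> t \in `[0, 1] ->
  s \in `[0, 1] -> geod (geod x y t) y s = geod x y (t + s * (1 - t)).
Proof.
move=> uG t01; have [g0 g1 gd] := geodP x y uG.
have [h [_ huniq]] := uG (geod x y t) y.
have mem (r : R) : r \in `[0, 1] -> t + r * (1 - t) \in `[0, 1].
  move: t01; rewrite !in_itv/= => /andP[? ?] /andP[? ?].
  by apply/andP; split; nra.
have tail : is_geodesic (geod x y t) y (fun r => geod x y (t + r * (1 - t))).
  split; first by rewrite mul0r addr0.
  - by rewrite mul1r subrKC.
  - move=> r r' r01 r'01; rewrite gd; [|exact: mem|exact: mem].
    have -> : mdist (geod x y t) y = (1 - t) * mdist x y.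
      rewrite -[X in mdist _ X]g1 gd//; last by rewrite in_itv/= ler01 lexx.
      move: t01; rewrite in_itv/= => /andP[_ t1].
      by rewrite distrC ger0_norm// subr_ge0.
    rewrite mulrA; congr (_ * _).
    have -> : t + r * (1 - t) - (t + r' * (1 - t)) = (r - r') * (1 - t) by ring.
    rewrite normrM; congr (_ * _); apply: ger0_norm.
    by move: t01; rewrite in_itv/= subr_ge0 => /andP[].
by move=> s01; rewrite -(huniq _ (geodP _ _ uG)) ?(huniq _ tail).
Qed.

Lemma dir_d_geod {f x y} {dphi : R -> R} {t : R} : uniquely_geodesic G ->
  diff_unit (fun r => f (geod x y r)) dphi -> t \in `[0, 1[ ->
  dir_d f (geod x y t) (geod (geod x y t) y) = (1 - t) * dphi t.
Proof.
move=> uG D t01; apply: cvg_lim => //.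
have t01' : t \in `[0, 1] by apply: subset_itv_co_cc.
apply: cvg_trans (diff_unit_right D t01); apply: near_eq_cvg; near=> s.
rewrite /diff_quot geod_geod// in_itv/=; apply/andP; split; near: s.
- exact: nbhs_right_ge.
- exact: nbhs_right_le.
Unshelve. all: by end_near. Qed.

(** The Lipschitz condition compares slopes per unit length; in terms of the parameter it bounds the
    growth of [dphi] from 0 with constant [L * mdist x y ^+ 2]. *)
Lemma lipschitz_gradient_descent {f U L x y} (t : R) :
  uniquely_geodesic G -> lipschitz_gradient U f L ->
  U x -> U y -> x <> y -> t \in `[0, 1] ->
  f (geod x y t) <=
    f x + t * dir_d f x (geod x y) + L / 2 * (t * mdist x y) ^+ 2.
Proof.
move=> uG [[_ C1] lip] Ux Uy xy t01.
have [g0 g1 gd] := geodP x y uG.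
have [dphi [_ D]] := C1 x y Ux Uy xy.
have d0 : 0 < mdist x y by rewrite mdist_gt0; exact/eqP.
have D0 : dir_d f x (geod x y) = dphi 0.
  have := dir_d_geod uG D (t := 0); rewrite in_itv/= lexx ltr01 g0 => -> //.
  by rewrite subr0 mul1r.
(* The factor [1 - s] in the derivative along the tail cancels against the length
   [(1 - s) * mdist x y] of the tail. *)
have dirD (s : R) : s \in `[0, 1[ ->
    dir_D f (geod x y s) (geod (geod x y s) y) = dphi s / mdist x y.
  move=> s01; rewrite /dir_D (dir_d_geod uG D s01).
  have [-> -> _] := geodP (geod x y s) y uG.
  move: s01; rewrite in_itv/= => /andP[s0 s1].
  rewrite -[X in mdist _ X]g1 gd ?in_itv/= ?ler01 ?lexx ?s0 ?ltW//.
  rewrite distrC gtr0_norm ?subr_gt0//; field.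
  by rewrite gt_eqF//= subr_eq0 gt_eqF.
have dphi_le : {in `]0, 1[, forall s : R,
    dphi s <= dphi 0 + L * mdist x y ^+ 2 * s}.
  move=> s; rewrite in_itv/= => /andP[s0 s1].
  have s01 : s \in `[0, 1[ by rewrite in_itv/= ltW.
  have z01 : (0 : R) \in `[0, 1[ by rewrite in_itv/= lexx ltr01.
  have dist_s : mdist (geod x y s) (geod x y 0) = s * mdist x y.
    by rewrite gd ?subr0 ?gtr0_norm//; apply: subset_itv_co_cc.
  have /= := lip x y Ux Uy xy s 0 s01 z01.
  rewrite !dirD// dist_s => /ler_normlW.
  rewrite -mulrBl ler_pdivrMr// => h; rewrite -lerBlDl (le_trans h)//.
  by lra.
have := quadratic_upper_bound D dphi_le t01; rewrite g0 D0.
by move/le_trans; apply; lra.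
Qed.

(** On a nonempty sublevel set [f] attains its minimum by compactness, and elsewhere it exceeds [a];
    if the set is empty, [a] itself is a lower bound. *)
Lemma sublevel_lower_bound {f U a} {rho : R} : boundedly_compact G ->
  level_bounded f -> {within U, continuous f} -> 0 < rho ->
  \bigcup_(x in sublevel f a) mclosed_ball x rho `<=` U ->
  exists m, forall x, m <= f x.
Proof.
move=> cG lb cf rho0 ballU.
have subU : sublevel f a `<=` U.
  move=> x fx; apply: ballU; exists x => //=.
  by rewrite /mclosed_ball/= mdistxx ltW.
(* [f] is only known to be continuous on [U]; the balls inside [U] put the
   limit points of the sublevel set there. *)
have cl : closed (sublevel f a).
  move=> z clz.
  have [w [fw]] : sublevel f a `&` ball z rho !=set0.
    by apply: clz; exact: nbhsx_ballx.
  rewrite ballEmdist/= metric_sym => wz.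
  have Uz : U z by apply: ballU; exists w => //; exact: ltW.
  rewrite /sublevel/= leNgt; apply/negP => afz.
  have fz : f @ within U (nbhs z) --> f z.
    exact: (subspace_continuousP _ _).1 cf z Uz.
  have : nbhs z (fun v => U v -> a < f v).
    by apply: (fz [set r | a < r]); apply: open_nbhs_nbhs.
  by move=> /clz[v [fv]] /(_ (subU _ fv)); rewrite ltNge fv.
have comp := cG _ cl (lb a).
have [[x0 fx0]|empty] := pselect (sublevel f a !=set0); last first.
  exists a => x; rewrite leNgt; apply/negP => fx; apply: empty; exists x.
  exact: ltW.
have [c ca minc] := compact_EVT_min (ex_intro _ x0 fx0) comp
  (continuous_subspaceW subU cf).
exists (f c) => x; have [fxa|afx] := leP (f x) a.
  by apply: minc; rewrite inE.
by rewrite (le_trans _ (ltW afx))//; move: ca; rewrite inE.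
Qed.

End Geometry.

(** * Real inequalities for the step scaling *)

Section StepSize.
Context {R : realType}.
Implicit Types (a u L rho delta p : R).

(** Isolates the factor [a] that cancels against the slope [- (a * rho)]. The remaining exponent is
    nonnegative when [p <= 2]. *)
Lemma powR_inv_split a p : 1 < p -> 0 < a ->
  a `^ (1 / (p - 1)) = a * a `^ (1 / (p - 1) - 1) /\
  a `^ (2 / (p - 1)) = (a * a `^ (1 / (p - 1) - 1)) ^+ 2.
Proof.
move=> p1 a0.
have E : a `^ (1 / (p - 1)) = a * a `^ (1 / (p - 1) - 1).
  rewrite -[X in _ = X * _]powRr1 ?ltW// -powRD ?subrKC//.
  by apply/implyP => _; rewrite gt_eqF.
split=> //; rewrite -E -powR_mulrn ?powR_ge0// -powRrM; congr powR.
by field; rewrite subr_eq0 gt_eqF.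
Qed.

(** With [C = (2 + L) / 2 * u], the left side is [C * (a * u) / (delta * rho)]. It lies below the
    first entry of the minimum if [C <= Num.sqrt delta], and below 1 by the second bound on
    [delta]. *)
Lemma step_lower_le {a u L rho delta} : 0 < a -> 0 < u -> 0 < L -> 0 < rho ->
  ((2 + L) / 2 * u) ^+ 2 <= delta ->
  (2 + L) / 2 * u * (a * u) / rho <= delta ->
  (2 + L) / (2 * delta) * ((a * u) ^+ 2 / (a * rho)) <=
    Num.min (a * u / (Num.sqrt delta * rho)) 1.
Proof.
move=> a0 u0 L0 rho0.
set C := (2 + L) / 2 * u => C2 CB.
have C0 : 0 < C by rewrite mulr_gt0// divr_gt0// addr_gt0.
have delta0 : 0 < delta by rewrite (lt_le_trans _ C2)// exprn_gt0.
have q0 : 0 < Num.sqrt delta by rewrite sqrtr_gt0.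
have q2 : Num.sqrt delta ^+ 2 = delta by rewrite sqr_sqrtr// ltW.
have Cq : C <= Num.sqrt delta.
  by rewrite (le_trans _ (ler_wsqrtr C2))// sqrtr_sqr ler_norm.
have -> : (2 + L) / (2 * delta) * ((a * u) ^+ 2 / (a * rho)) =
    C * (a * u) / (delta * rho).
  by rewrite /C; field; rewrite !gt_eqF.
rewrite le_min; apply/andP; split; last first.
  rewrite ler_pdivrMr ?mulr_gt0// mul1r.
  by move: CB; rewrite ler_pdivrMr.
rewrite -[in leLHS]q2.
have -> : C * (a * u) / (Num.sqrt delta ^+ 2 * rho) =
    C / Num.sqrt delta * (a * u / (Num.sqrt delta * rho)).
  by field; rewrite !gt_eqF.
apply: ler_piMl; first by rewrite ltW// divr_gt0// mulr_gt0.
by rewrite ler_pdivrMr// mul1r.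
Qed.

(** The lower bound on [l] makes the linear gain at least [(1 + L / 2) * w ^+ 2 / delta]; the upper
    one makes the quadratic loss at most [L / 2 * w ^+ 2 / delta]. *)
Lemma quadratic_decrease {w a L rho delta l : R} : 0 < a -> 0 < L -> 0 < rho ->
  0 < delta -> 0 < l -> 0 < w ->
  (2 + L) / (2 * delta) * (w ^+ 2 / (a * rho)) <= l ->
  l <= w / (Num.sqrt delta * rho) ->
  l * - (a * rho) + L / 2 * (l * rho) ^+ 2 <= - (1 / delta) * w ^+ 2.
Proof.
move=> a0 L0 rho0 delta0 l0 w0.
have q0 : 0 < Num.sqrt delta by rewrite sqrtr_gt0.
have q2 : Num.sqrt delta ^+ 2 = delta by rewrite sqr_sqrtr// ltW.
rewrite mulrA ler_pdivrMr ?mulr_gt0// => lower.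
rewrite ler_pdivlMr ?mulr_gt0// => upper.
have {}upper : (l * rho) ^+ 2 <= w ^+ 2 / delta.
  have lrho0 : 0 <= l * rho by rewrite ltW// mulr_gt0.
  rewrite ler_pdivlMr// -q2 -exprMn ler_sqr ?nnegrE; [lra| |exact: ltW].
  by rewrite mulr_ge0// ltW.
have {}lower : (2 + L) / 2 * (w ^+ 2 / delta) <= l * (a * rho).
  rewrite (le_trans _ lower)// le_eqVlt; apply/orP; left; apply/eqP.
  by field; rewrite gt_eqF.
have : L / 2 * (l * rho) ^+ 2 <= L / 2 * (w ^+ 2 / delta).
  by rewrite ler_wpM2l// ltW// divr_gt0.
by rewrite mul1r mulNr [_^-1 * _]mulrC; lra.
Qed.

End StepSize.

(** * Steepest descent steps and the uniform choice of [delta] *)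

Lemma steepest_descent_slope {R : realType} {G : metricType R} {f : G -> R}
    {x y : G} {rho : R} : uniquely_geodesic G -> 0 < rho ->
  descent_points f x y -> steepest_step f x y rho ->
  0 < fine (steepness f x) /\
  dir_d f x (geod x y) = - (fine (steepness f x) * rho).
Proof.
move=> uG rho0 [_ neg] [[_ _ dinf] steep dxy].
have [g0 g1 _] := geodP x y uG.
move: steep neg; rewrite /Dn_inf /dir_D dinf g0 g1 dxy.
rewrite -EFinM lte_fin => steep neg.
(* The steepness is the negative of a real slope, so it is finite and [fine] loses nothing; strict
   descent makes it positive. *)
have -> : steepness f x = (- (dir_d f x (geod x y) / rho))%:E.
  by rewrite EFinN steep oppeK.
rewrite /= oppr_gt0; split=> //.
by rewrite mulNr opprK divfK// gt_eqF.
Qed.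

Theorem theorem1p3 (R : realType) (G : metricType R) (p c : R)
  (hp : 1 < p <= 2) (hc : 0 < c)
  (Gcompact : boundedly_compact G) (Gconvex : uniformly_convex G p c)
  (f : G -> R) (U : set G) (L rho : R) (x0 : G)
  (hL : 0 < L) (hrho : 0 < rho)
  (Uconvex : geod_convex U)
  (f_level : level_bounded f)
  (f_lip : lipschitz_gradient U f L)
  (lev_int : \bigcup_(x in sublevel f (f x0)) mclosed_ball x rho
               `<=` geod_interior U) :
  exists delta0 : R, 0 < delta0 /\
    forall (x y : nat -> G) (lambda : nat -> R),
      x 0%N = x0 ->
      basic_descent f x y lambda ->
      (forall k, executed f x k -> steepest_step f (x k) (y k) rho) ->
      forall delta : R, delta0 <= delta ->
        (forall k, executed f x k -> sublevel f (f x0) (x k) ->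
           step_range f p L delta (x k) (y k) !=set0 /\
           (step_range f p L delta (x k) (y k) (lambda k) ->
              sufficient_decrease f p delta (x k) (x k.+1))) /\
        ((forall k, executed f x k ->
            step_range f p L delta (x k) (y k) (lambda k)) ->
         forall k, executed f x k ->
           sufficient_decrease f p delta (x k) (x k.+1)).
Proof.
have [uG _] := Gconvex.
have [p1 p2] := andP hp.
have subU : \bigcup_(x in sublevel f (f x0)) mclosed_ball x rho `<=` U.
  by move=> z /lev_int[].
have [m mf] := sublevel_lower_bound Gcompact f_level f_lip.1.1 hrho subU.
pose e := 1 / (p - 1) - 1.
have e0 : 0 <= e.
  by rewrite subr_ge0 ler_pdivlMr ?subr_gt0// mul1r; lra.
(* At full step the quadratic bound gives [m <= f x0 - a * rho + L / 2 * rho ^+ 2], so [B] bounds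
   every steepness [a] met below; the 1 keeps [B] positive. *)
pose B := Num.max 1 ((f x0 - m + L / 2 * rho ^+ 2) / rho).
have B1 : 1 <= B by rewrite le_max lexx.
have B0 : 0 < B by rewrite (lt_le_trans ltr01).
pose C := (2 + L) / 2 * B `^ e.
have C0 : 0 < C.
  by rewrite mulr_gt0 ?powR_gt0// divr_gt0// addr_gt0.
have CB0 : 0 < C * (B * B `^ e) / rho.
  by rewrite divr_gt0// mulr_gt0// mulr_gt0// powR_gt0.
(* The two summands dominate the two lower bounds on [delta] in [step_lower_le], with [a] replaced
   by [B]; neither depends on the run. *)
exists (C ^+ 2 + C * (B * B `^ e) / rho).
have C20 : 0 < C ^+ 2 by rewrite exprn_gt0.
split=> [|x y lambda xx0 run steep delta ledelta]; first by rewrite addr_gt0.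
have delta0 : 0 < delta by rewrite (lt_le_trans _ ledelta)// addr_gt0.
have step k : executed f x k -> sublevel f (f x0) (x k) ->
    step_range f p L delta (x k) (y k) !=set0 /\
    (step_range f p L delta (x k) (y k) (lambda k) ->
      sufficient_decrease f p delta (x k) (x k.+1)).
  move=> ex fxk; have [desc lam ->] := run k ex.
  have [a0 slope] := steepest_descent_slope uG hrho desc (steep k ex).
  have [_ _ dxy] := steep k ex.
  have Uball z : mdist (x k) z <= rho -> U z.
    by move=> ?; apply: subU; exists (x k).
  have Ux : U (x k) by apply: Uball; rewrite mdistxx ltW.
  have Uy : U (y k) by apply: Uball; rewrite dxy.
  have xy : x k <> y k by apply/eqP; rewrite -mdist_gt0 dxy.
  have descent t := lipschitz_gradient_descent t uG f_lip Ux Uy xy.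
  rewrite /step_range /step_lower /step_upper /sufficient_decrease slope dxy.
  set a := fine (steepness f (x k)) in a0 slope *.
  have aB : a <= B.
    rewrite le_max ler_pdivlMr//; apply/orP; right.
    have := descent 1; rewrite slope dxy in_itv/= lexx ler01 => /(_ isT).
    have := mf (geod (x k) (y k) 1); move: fxk; rewrite /sublevel/=.
    by rewrite !mul1r; lra.
  have [-> ->] := powR_inv_split a p p1 a0.
  rewrite -/e; set u := a `^ e.
  have u0 : 0 < u by exact: powR_gt0.
  have uB : u <= B `^ e by apply: ge0_ler_powR => //; rewrite nnegrE ltW.
  have Cu : (2 + L) / 2 * u <= C.
    by rewrite ler_wpM2l// ltW// divr_gt0// addr_gt0.
  have Cu0 : 0 < (2 + L) / 2 * u by rewrite mulr_gt0// divr_gt0// addr_gt0.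
  have -> : - ((2 + L) / (2 * delta)) * ((a * u) ^+ 2 / - (a * rho)) =
      (2 + L) / (2 * delta) * ((a * u) ^+ 2 / (a * rho)).
    by field; rewrite !gt_eqF.
  have Cu2 : ((2 + L) / 2 * u) ^+ 2 <= delta.
    apply: le_trans ledelta; apply: (@le_trans _ _ (C ^+ 2)).
      by rewrite ler_sqr// nnegrE ltW.
    by rewrite lerDl ltW.
  have CuB : (2 + L) / 2 * u * (a * u) / rho <= delta.
    apply: le_trans ledelta; apply: (@le_trans _ _ (C * (B * B `^ e) / rho)).
      rewrite ler_pM2r ?invr_gt0//.
      apply: ler_pM => //; first exact: ltW.
        by rewrite ltW// mulr_gt0.
      by rewrite ler_pM// ltW.
    by rewrite lerDr ltW.
  have range := step_lower_le a0 u0 hL hrho Cu2 CuB.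
  split.
    (* The witness is the largest admissible scaling. *)
    exists (Num.min (a * u / (Num.sqrt delta * rho)) 1); split => /=.
      by rewrite in_itv/= range ge_min lexx.
    rewrite in_itv/= lt_min ltr01 ge_min lexx orbT !andbT.
    by rewrite divr_gt0 ?mulr_gt0 ?sqrtr_gt0.
  move=> []/=; rewrite !in_itv/= => /andP[lower upper] /andP[l0 l1].
  have lam01 : lambda k \in `[0, 1] by rewrite in_itv/= ltW.
  have := descent _ lam01; rewrite slope dxy.
  have := quadratic_decrease a0 hL hrho delta0 l0 (mulr_gt0 a0 u0) lower upper.
  by lra.
split=> // ranges.
have exW j k : (j <= k)%N -> executed f x k -> executed f x j.
  by move=> jk ex i ij; apply: ex; exact: leq_trans jk.
(* The decrease at one step keeps the next iterate in the sublevel set, which [step] requires. *)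
have sub k : executed f x k -> sublevel f (f x0) (x k).
  elim: k => [_|k IH ex]; first by rewrite /sublevel/= xx0.
  have exk := exW _ _ (leqnSn k) ex.
  have := (step k exk (IH exk)).2 (ranges k exk).
  rewrite /sufficient_decrease => dec.
  apply: le_trans (IH exk); rewrite -subr_le0 (le_trans dec)//.
  by rewrite mulNr oppr_le0 mulr_ge0 ?powR_ge0// divr_ge0// ltW.
by move=> k ex; apply: (step k ex (sub k ex)).2; exact: ranges.
Qed.
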